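(* Let $m\ge 2$, $n\ge 1$ and let $\mathcal{A}=(a_{i_1\cdots i_m})$ be a real $m$-order $n$-dimensional tensor (not necessarily symmetric). A real number $\mu$ is a Pareto $Z$-eigenvalue of $\mathcal{A}$ if and only if there exist a nonempty subset $N\subseteq\{1,2,\ldots,n\}$ and a vector $w=(w_i)_{i\in N}\in\mathbb{R}^{|N|}$ such that $$\mathcal{A}^{N}w^{m-1}=\mu (w^Tw)^{\frac{m-2}{2}}w,\qquad w\in\mathbb{R}^{|N|}_{++},$$ $$\sum_{i_2,\ldots,i_m\in N}a_{ii_2\cdots i_m}w_{i_2}w_{i_3}\cdots w_{i_m}\ge 0\quad\text{for all } i\in\{1,2,\ldots,n\}\setminus N.$$ In such a case, the vector $y\in\mathbb{R}^{n}_+$ defined by $y_i=w_i$ for $i\in N$ and $y_i=0$ for $i\in\{1,2,\ldots,n\}\setminus N$ is a Pareto $Z$-eigenvector of $\mathcal{A}$ associated to $\mu$.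
   Context: An $m$-order $n$-dimensional real tensor is an array $\mathcal{A}=(a_{i_1\cdots i_m})$ of real numbers, $i_1,\ldots,i_m\in\{1,\ldots,n\}$. For $x\in\mathbb{R}^n$, $\mathcal{A}x^m=\sum_{i_1,\ldots,i_m=1}^n a_{i_1\cdots i_m}x_{i_1}\cdots x_{i_m}$, and $\mathcal{A}x^{m-1}\in\mathbb{R}^n$ is the vector with components $(\mathcal{A}x^{m-1})_i=\sum_{i_2,\ldots,i_m=1}^n a_{ii_2\cdots i_m}x_{i_2}\cdots x_{i_m}$. Vector inequalities are componentwise; $\mathbb{R}^k_+=\{x\in\mathbb{R}^k: x\ge 0\}$ and $\mathbb{R}^k_{++}=\{x\in\mathbb{R}^k: x>0\}$ (all components positive). A real number $\mu$ is a Pareto $Z$-eigenvalue of $\mathcal{A}$ if there is a non-zero $x\in\mathbb{R}^n$ with $\mathcal{A}x^m=\mu (x^Tx)^{\frac{m}{2}}$, $\mathcal{A}x^{m-1}-\mu (x^Tx)^{\frac{m}{2}-1}x\ge 0$ and $x\ge 0$; such an $x$ is a Pareto $Z$-eigenvector associated to $\mu$. For nonempty $N\subseteq\{1,\ldots,n\}$, the principal sub-tensor $\mathcal{A}^N$ is the $m$-order $|N|$-dimensional tensor obtained by setting $x_i=0$ for $i\notin N$, i.e. $\mathcal{A}^N=(a_{i_1\cdots i_m})_{i_1,\ldots,i_m\in N}$; vectors in $\mathbb{R}^{|N|}$ are indexed by the elements of $N$. *)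

(* Defs.v *)
From mathcomp Require Import all_boot all_order all_algebra.
From mathcomp Require Import reals exp.

Set Implicit Arguments.
Unset Strict Implicit.
Unset Printing Implicit Defensive.

Import Order.TTheory GRing.Theory Num.Theory.
Local Open Scope ring_scope.

(* Order-[m] tensors with indices in an arbitrary finite type [I], so that the
   same notions apply to tensors on ['I_n] and to their principal sub-tensors,
   indexed by the elements of a subset.  The multi-index length is written
   [m.-1.+1], which equals [m] for [m >= 1], so that [i :: t] is a multi-index
   when [t] is an [m.-1]-tuple; [m = 0] is a junk value. *)
Definition tensor (R : realType) (m : nat) (I : finType) :=
  {ffun (m.-1).+1.-tuple I -> R}.

Section Tensor.
Variables (R : realType) (m : nat) (I : finType).
Implicit Types (A : tensor R m I) (x : {ffun I -> R}) (mu : R).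

(* A x^m *)
Definition tensor_form A x : R :=
  \sum_(t : (m.-1).+1.-tuple I) A t * \prod_(j <- t) x j.

(* A x^(m-1) *)
Definition tensor_apply A x : {ffun I -> R} :=
  [ffun i => \sum_(t : (m.-1).-tuple I)
               A [tuple of i :: t] * \prod_(j <- t) x j].

(* x^T x *)
Definition sqnorm x : R := \sum_i x i * x i.

Definition pareto_Z_eigenvector A mu x : Prop :=
  [/\ x != 0,
      tensor_form A x = mu * sqnorm x `^ (m%:R / 2),
      forall i, 0 <= tensor_apply A x i - mu * sqnorm x `^ (m%:R / 2 - 1) * x i
    & forall i, 0 <= x i].

Definition pareto_Z_eigenvalue A mu : Prop :=
  exists x, pareto_Z_eigenvector A mu x.

Variable N : {set I}.

Definition principal_subtensor A : tensor R m {i : I | i \in N} :=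
  [ffun t : (m.-1).+1.-tuple {i : I | i \in N} => A [tuple of map val t]].

Definition zero_extension (w : {ffun {i : I | i \in N} -> R}) : {ffun I -> R} :=
  [ffun i => oapp w 0 (insub i)].

End Tensor.

(* Main.v *)
(* Pairing A x^(m-1) - mu |x|^(m-2) x >= 0 with x >= 0 gives
   A x^m - mu |x|^m = 0, so complementarity holds: the i-th component vanishes
   wherever x_i > 0.  Hence a Pareto Z-eigenvector restricts to a positive
   Z-eigenvector of the principal sub-tensor on its support N, and off N the
   term mu |x|^(m-2) x_i disappears.  Conversely, extending w by zero kills
   every multi-index leaving N, which turns sums over N into A y^(m-1). *)
Require Import Defs.
From mathcomp Require Import all_boot all_order all_algebra.
From mathcomp Require Import reals exp.

Set Implicit Arguments.
Unset Strict Implicit.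
Unset Printing Implicit Defensive.

Import Order.TTheory GRing.Theory Num.Theory.
Local Open Scope ring_scope.

Lemma sum_tuple_cons (V : nmodType) (I : finType) (k : nat)
    (F : k.+1.-tuple I -> V) :
  \sum_t F t = \sum_i \sum_(t : k.-tuple I) F [tuple of i :: t].
Proof.
rewrite pair_big /=.
rewrite (reindex (fun p : I * k.-tuple I => [tuple of p.1 :: p.2])) //=.
exists (fun t => (thead t, [tuple of behead t])) => [[i t] _|t _] /=.
  by congr (_, _); apply: val_inj.
by rewrite -tuple_eta.
Qed.

(** Splitting off the first index exhibits A x^m as the pairing of x with A x^(m-1), so
    componentwise facts can be summed. *)
Lemma tensor_formE (R : realType) (m : nat) (I : finType) (A : tensor R m I)
    (x : {ffun I -> R}) :
  tensor_form A x = \sum_i x i * tensor_apply A x i.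
Proof.
rewrite /tensor_form sum_tuple_cons; apply: eq_bigr => i _.
rewrite ffunE mulr_sumr; apply: eq_bigr => t _.
by rewrite big_cons mulrCA.
Qed.

Section ZeroExtension.
Variables (R : realType) (I : finType) (N : {set I}).
Implicit Type w : {ffun {i : I | i \in N} -> R}.

Lemma zero_extension_val w i : zero_extension w (val i) = w i.
Proof. by rewrite ffunE valK. Qed.

Lemma zero_extension_out w i : i \notin N -> zero_extension w i = 0.
Proof. by move=> iN; rewrite ffunE insubN. Qed.

Lemma sqnorm_zero_extension w : sqnorm (zero_extension w) = sqnorm w.
Proof.
rewrite /sqnorm (bigID (mem N)) /= [X in _ + X]big1 ?addr0; last first.
  by move=> i /zero_extension_out ->; rewrite mul0r.
by rewrite big_sub; apply: eq_bigr => i _; rewrite !zero_extension_val.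
Qed.

(** A multi-index with an entry outside N has a zero factor in its product; the surviving ones are
    exactly the injective image of the multi-indices over N. *)
Lemma sum_zero_extension w (k : nat) (F : k.-tuple I -> R) :
  \sum_t F t * \prod_(j <- t) zero_extension w j =
  \sum_(t : k.-tuple {i : I | i \in N}) F [tuple of map val t] * \prod_(j <- t) w j.
Proof.
pose h (t : k.-tuple {i : I | i \in N}) : k.-tuple I := [tuple of map val t].
have hI : injective h.
  by move=> s t /(congr1 val) /(inj_map val_inj) /val_inj.
rewrite (bigID (mem (h @: setT))) /= [X in _ + X]big1 ?addr0; last first.
  move=> t /negP tN; have [/allP tall|] := boolP (all (mem N) t); last first.
    move=> /allPn [j jt jN]; rewrite (big_rem j jt) /= zero_extension_out //.
    by rewrite mul0r mulr0.
  case: tN; apply/imsetP.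
  (* All entries of [t] lie in N, so it lifts entry by entry to the subtype, contradicting that [t]
     is outside the image of [h]. *)
  have [s st] : exists s : seq {i : I | i \in N}, map val s = t.
    elim: (tval t) tall => [|i u IH] uN; first by exists [::].
    have [|s <-] := IH; first by move=> j ju; apply: uN; rewrite inE ju orbT.
    by exists (exist _ i (uN i (mem_head _ _)) :: s).
  have /eqP sk : size s = k by rewrite -(size_map val) st size_tuple.
  by exists (Tuple sk); rewrite ?inE //; apply: val_inj.
rewrite big_imset /=; last by move=> s t _ _; apply: hI.
rewrite big_mkcond /=; apply: eq_bigr => t _; rewrite inE big_map.
by under eq_bigr do rewrite zero_extension_val.
Qed.

(** The index [i] is unrestricted: in N it yields the principal sub-tensor, outside N the sums of
    the sign condition. *)
Lemma tensor_apply_zero_extension (m : nat) (A : tensor R m I) w i :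
  tensor_apply A (zero_extension w) i =
  \sum_(t : (m.-1).-tuple {j : I | j \in N})
    A [tuple of i :: map val t] * \prod_(j <- t) w j.
Proof.
rewrite ffunE (sum_zero_extension w (fun t => A [tuple of i :: t])).
by apply: eq_bigr => t _; congr (A _ * _); apply: val_inj.
Qed.

Lemma tensor_apply_principal (m : nat) (A : tensor R m I) w i :
  tensor_apply (principal_subtensor N A) w i =
  tensor_apply A (zero_extension w) (val i).
Proof.
rewrite tensor_apply_zero_extension ffunE; apply: eq_bigr => t _.
by rewrite ffunE; congr (A _ * _); apply: val_inj.
Qed.

End ZeroExtension.

Lemma sqnorm_gt0 (R : realType) (I : finType) (x : {ffun I -> R}) :
  x != 0 -> 0 < sqnorm x.
Proof.
move=> x0; rewrite lt_def sumr_ge0 ?andbT; last first.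
  by move=> i _; rewrite -expr2 sqr_ge0.
apply: contra x0 => /eqP /psumr_eq0P x0; apply/eqP/ffunP => i; rewrite ffunE.
apply/eqP; rewrite -sqrf_eq0 expr2 x0 // => j _.
by rewrite -expr2 sqr_ge0.
Qed.

(** With s = x^T x, this reconciles the exponent m/2 - 1 of the vector condition with the exponent
    m/2 of the scalar one. *)
Lemma powR_sub1M (R : realType) (s a : R) : 0 < s -> s `^ (a - 1) * s = s `^ a.
Proof.
move=> s0; rewrite -[X in _ * X]powRr1 ?ltW // -powRD ?subrK //.
by rewrite (gt_eqF s0) implybT.
Qed.

Lemma pareto_complementarity (R : realType) (m : nat) (I : finType)
    (A : tensor R m I) (mu : R) (x : {ffun I -> R}) (i : I) :
  pareto_Z_eigenvector A mu x -> 0 < x i ->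
  tensor_apply A x i = mu * sqnorm x `^ (m%:R / 2 - 1) * x i.
Proof.
move=> [x0 xA Ax x_ge0] xi.
pose c := mu * sqnorm x `^ (m%:R / 2 - 1).
(* A zero sum of nonnegative terms has only zero terms; the factor [x i] is then cancelled. *)
have /psumr_eq0P sum0 : \sum_j x j * (tensor_apply A x j - c * x j) = 0.
  under eq_bigr do rewrite mulrBr mulrCA.
  rewrite sumrB -tensor_formE xA -mulr_sumr -/(sqnorm x) -mulrA.
  by rewrite powR_sub1M ?sqnorm_gt0 ?subrr.
have /eqP := sum0 (fun j _ => mulr_ge0 (x_ge0 j) (Ax j)) i isT.
by rewrite mulf_eq0 gt_eqF //= subr_eq0 => /eqP.
Qed.

Theorem theorem3p2 (R : realType) (m n : nat) (hm : (2 <= m)%N) (hn : (1 <= n)%N)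
    (A : tensor R m 'I_n) (mu : R) :
  let pareto_data (N : {set 'I_n}) (w : {ffun {i : 'I_n | i \in N} -> R}) : Prop :=
    [/\ N != set0,
        forall i : {i : 'I_n | i \in N},
          tensor_apply (principal_subtensor N A) w i
            = mu * sqnorm w `^ ((m%:R - 2) / 2) * w i,
        forall i, 0 < w i
      & forall i : 'I_n, i \notin N ->
          0 <= \sum_(t : (m.-1).-tuple {j : 'I_n | j \in N})
                 A [tuple of i :: map val t] * \prod_(j <- t) w j] in
  (pareto_Z_eigenvalue A mu <->
     exists (N : {set 'I_n}) (w : {ffun {i : 'I_n | i \in N} -> R}),
       pareto_data N w)
  /\
  (forall (N : {set 'I_n}) (w : {ffun {i : 'I_n | i \in N} -> R}),
     pareto_data N w -> pareto_Z_eigenvector A mu (zero_extension w)).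
Proof.
move=> pareto_data.
have expE : (m%:R - 2) / 2 = m%:R / 2 - 1 :> R.
  by rewrite mulrBl divff ?pnatr_eq0.
have suff_data N w : pareto_data N w ->
    pareto_Z_eigenvector A mu (zero_extension w).
  move=> [/set0Pn[i0 i0N] wA w_gt0 outA].
  (* Nonemptiness of N provides a positive coordinate. *)
  have y0 : zero_extension w != 0.
    apply/eqP => /ffunP /(_ i0); rewrite ffunE insubT ffunE /= => wi0.
    by have := w_gt0 (exist _ i0 i0N); rewrite wi0 ltxx.
  have inA i : i \in N -> tensor_apply A (zero_extension w) i =
      mu * sqnorm (zero_extension w) `^ (m%:R / 2 - 1) * zero_extension w i.
    move=> iN; rewrite -[i]/(val (exist (fun i => i \in N) i iN)).
    by rewrite -tensor_apply_principal wA expE sqnorm_zero_extension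
      zero_extension_val.
  split=> // [|i|i].
  (* The two sides agree term by term: on N by the eigenvalue equation, off N because both terms
     contain a zero coordinate. *)
  - rewrite tensor_formE -(powR_sub1M _ (sqnorm_gt0 y0)) mulrA mulr_sumr.
    apply: eq_bigr => i _; have [iN|iN] := boolP (i \in N).
      by rewrite inA // mulrCA.
    by rewrite zero_extension_out // !mul0r mulr0.
  - have [iN|iN] := boolP (i \in N); first by rewrite inA // subrr.
    rewrite zero_extension_out // mulr0 subr0 tensor_apply_zero_extension.
    exact: outA.
  - have [iN|iN] := boolP (i \in N); last by rewrite zero_extension_out.
    by rewrite ffunE insubT; apply/ltW/w_gt0.
split=> //; split=> [[x xP]|[N [w wP]]]; last first.
  by exists (zero_extension w); apply: suff_data.
have [x0 _ Ax x_ge0] := xP.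
(* N is the support of [x], since [x] is nonnegative, so extending the restriction [w] by zero
   recovers [x]. *)
pose N := [set i | 0 < x i]; pose w := [ffun i : {i | i \in N} => x (val i)].
have N_out i : i \notin N -> x i = 0.
  by rewrite inE lt_def x_ge0 andbT negbK => /eqP.
have wx : zero_extension w = x.
  apply/ffunP => i; have [iN|iN] := boolP (i \in N).
    by rewrite ffunE insubT /= ffunE.
  by rewrite zero_extension_out // N_out.
exists N, w; split=> [|i|i|i iN].
- apply: contra x0 => /eqP N0; apply/eqP/ffunP => i.
  by rewrite ffunE N_out // N0 inE.
- have xi : 0 < x (val i) by have := valP i; rewrite inE.
  rewrite tensor_apply_principal -sqnorm_zero_extension wx expE [w i]ffunE.
  exact: pareto_complementarity.
- by rewrite ffunE; have := valP i; rewrite inE.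
- rewrite -tensor_apply_zero_extension wx.
  by have := Ax i; rewrite N_out // mulr0 subr0.
Qed.
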